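(* Let $\alpha_0,\dots,\alpha_4$ be complex parameters with $\alpha_0+\alpha_1+2\alpha_2+\alpha_3+\alpha_4=1$. For the system of type $D_4^{(1)}$ $$\frac{dx}{dt}=\frac{2x^2y-x^2+(\alpha_0+\alpha_1)x-2w}{t}+1,\qquad \frac{dy}{dt}=\frac{-2xy^2+2xy-(\alpha_0+\alpha_1)y+\alpha_1}{t},$$ $$\frac{dz}{dt}=\frac{2z^2w-tz^2-(1-\alpha_3-\alpha_4)z+1-2y}{t},\qquad \frac{dw}{dt}=\frac{-2zw^2+2tzw+(1-\alpha_3-\alpha_4)w+\alpha_3t}{t},$$ make the change of parameters and variables $$A_0=\frac{\alpha_0-\alpha_1}{2},\quad A_1=\alpha_1,\quad A_2=\alpha_2,\quad A_3=\alpha_3,\quad A_4=\alpha_4,$$ $$X=\frac1x,\quad Y=-(xy+\alpha_1)x,\quad Z=z,\quad W=w.$$ Then the system can also be written in the new variables $X,Y,Z,W$ and parameters $A_0,\dots,A_4$ as a Hamiltonian system, and this new system coincides with the system of type $B_4^{(1)}$ $$\frac{dX}{dt}=\frac{\partial H_{B_4^{(1)}}}{\partial Y},\quad \frac{dY}{dt}=-\frac{\partial H_{B_4^{(1)}}}{\partial X},\quad \frac{dZ}{dt}=\frac{\partial H_{B_4^{(1)}}}{\partial W},\quad \frac{dW}{dt}=-\frac{\partial H_{B_4^{(1)}}}{\partial Z}$$ with the Hamiltonian $$tH_{B_4^{(1)}}=X^2Y(Y-t)-X\{2A_0Y+A_1t\}+Y+Z^2W(W-t)-Z\{(1-A_3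-A_4)W+A_3t\}+W+2XW(XY+A_1).$$
   Context: The system of type $D_4^{(1)}$ is the Hamiltonian system $dx/dt=\partial H/\partial y$, $dy/dt=-\partial H/\partial x$, $dz/dt=\partial H/\partial w$, $dw/dt=-\partial H/\partial z$ with $tH=x^2y(y-1)+x\{(\alpha_0+\alpha_1)y-\alpha_1\}+ty+z^2w(w-t)-z\{(1-\alpha_3-\alpha_4)w+\alpha_3t\}+w-2yw$. The parameters of the system of type $B_4^{(1)}$ satisfy $2A_0+2A_1+2A_2+A_3+A_4=1$. *)

(* Defs.v *)
From mathcomp Require Import all_boot all_order all_algebra complex.
From mathcomp Require Import all_classical all_reals all_analysis.

Set Implicit Arguments.
Unset Strict Implicit.
Unset Printing Implicit Defensive.

Import Order.TTheory GRing.Theory Num.Theory.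
Import numFieldNormedType.Exports.

Local Open Scope ring_scope.
Local Open Scope classical_set_scope.
Local Open Scope complex_scope.

(* [R[i]] repackaged as a [numClosedFieldType], because the canonical topology
   and norm of [numFieldNormedType.Exports] are not inferred on a bare [R[i]].
   Derivatives over [Cplx R] are therefore complex derivatives. *)
Definition Cplx (R : realType) : numClosedFieldType := R[i].

(* A non-autonomous Hamiltonian with two degrees of freedom, with arguments
   t, x, y, z, w; the canonical pairs are (x, y) and (z, w). *)
Definition hamiltonian (R : realType) :=
  Cplx R -> Cplx R -> Cplx R -> Cplx R -> Cplx R -> Cplx R.

(* The set [D] of times is arbitrary: it is typically an open set on which the
   functions are holomorphic, but each equation at [t] only involves the
   functions near [t], so [D] may also be a single point. *)
Definition hamiltonian_system (R : realType) (H : hamiltonian R)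
    (D : set (Cplx R)) (x y z w : Cplx R -> Cplx R) : Prop :=
  forall t, D t ->
    [/\ is_derive t 1 x (derive1 (fun v => H t (x t) v (z t) (w t)) (y t)),
        is_derive t 1 y (- derive1 (fun v => H t v (y t) (z t) (w t)) (x t)),
        is_derive t 1 z (derive1 (fun v => H t (x t) (y t) (z t) v) (w t)) &
        is_derive t 1 w (- derive1 (fun v => H t (x t) (y t) v (w t)) (z t))].

(* The parameter alpha2 does not occur in the equations; it only enters the
   normalization of the parameters. Same remark for A2 below. *)
Definition D4_system (R : realType) (alpha0 alpha1 alpha3 alpha4 : Cplx R)
    (D : set (Cplx R)) (x y z w : Cplx R -> Cplx R) : Prop :=
  forall t, D t ->
    [/\ is_derive t 1 x
          ((2 * x t ^+ 2 * y t - x t ^+ 2 + (alpha0 + alpha1) * x t - 2 * w t)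
             / t + 1),
        is_derive t 1 y
          ((- 2 * x t * y t ^+ 2 + 2 * x t * y t - (alpha0 + alpha1) * y t
             + alpha1) / t),
        is_derive t 1 z
          ((2 * z t ^+ 2 * w t - t * z t ^+ 2 - (1 - alpha3 - alpha4) * z t + 1
             - 2 * y t) / t) &
        is_derive t 1 w
          ((- 2 * z t * w t ^+ 2 + 2 * t * z t * w t
             + (1 - alpha3 - alpha4) * w t + alpha3 * t) / t)].

Definition H_B4 (R : realType) (A0 A1 A3 A4 : Cplx R) : hamiltonian R :=
  fun t X Y Z W =>
    (X ^+ 2 * Y * (Y - t) - X * (2 * A0 * Y + A1 * t) + Y
     + Z ^+ 2 * W * (W - t) - Z * ((1 - A3 - A4) * W + A3 * t) + W
     + 2 * X * W * (X * Y + A1)) / t.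

(* Main.v *)
Require Import Defs.
From mathcomp Require Import all_boot all_order all_algebra complex.
From mathcomp Require Import all_classical all_reals all_analysis.
From mathcomp Require Import ring.

Set Implicit Arguments.
Unset Strict Implicit.
Unset Printing Implicit Defensive.

Import Order.TTheory GRing.Theory Num.Theory.
Import numFieldNormedType.Exports.

Local Open Scope ring_scope.
Local Open Scope classical_set_scope.

(** The change of variables [(x, y) |-> (1 / x, - (x y + alpha1) x)] is an
    involution of [{x <> 0}], so the equations can be transported in both
    directions by the same two differentiation rules; what is left is a rational
    identity for each equation. The partial derivatives of the Hamiltonian are
    immediate because it is quadratic in each variable. *)

Lemma derive1_quadratic (K : numFieldType) (f : K -> K) (a b c v : K) :
  (forall u, f u = a * u ^+ 2 + b * u + c) -> derive1 f v = 2 * a * v + b.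
Proof.
move=> fE.
have -> : f = (a \*: ((id : K -> K) ^+ 2) + b \*: (id : K -> K)) + cst c.
  by apply/funext => u; rewrite fE /= !fctE.
rewrite derive1E derive_val /= expr1 addr0 /GRing.scale /=; ring.
Qed.

Lemma is_derive_div1 (K : numFieldType) (x : K -> K) (t dx : K) :
  x t != 0 -> is_derive t 1 x dx ->
  is_derive t 1 (fun s => 1 / x s) (- dx / x t ^+ 2).
Proof.
move=> xt0 [xD <-].
have -> : (fun s => 1 / x s) = (fun s => (x s)^-1).
  by apply/funext => s; rewrite div1r.
apply: DeriveDef; first exact: derivableV.
by rewrite deriveV// /GRing.scale /=; field.
Qed.

Lemma is_derive_flip (K : numFieldType) (x y : K -> K) (a t dx dy : K) :
  is_derive t 1 x dx -> is_derive t 1 y dy ->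
  is_derive t 1 (fun s => - (x s * y s + a) * x s)
    (- (2 * x t * y t + a) * dx - x t ^+ 2 * dy).
Proof.
move=> xD yD.
have -> : (fun s => - (x s * y s + a) * x s) = - (x * y + cst a) * x.
  by apply/funext => s; rewrite !fctE.
apply: is_derive_eq; rewrite !fctE /GRing.scale /=; ring.
Qed.

(** The product of the two flipped coordinates is [- (x * y + a)]; adding [a] leaves [- x * y], and
    the factor [- (1 / x)] restores [y]. *)
Lemma flipK (K : fieldType) (a x y : K) : x != 0 ->
  - (1 / x * (- (x * y + a) * x) + a) * (1 / x) = y.
Proof. by move=> x0; field. Qed.

(** Differentiability of [x] and [y] is a conclusion here: both functions are recovered as the flip
    of [X] and [Y], to which the two forward rules apply. *)
Lemma is_derive_unflip (K : numFieldType) (x y : K -> K) (a t dX dY : K) :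
  let X := fun s => 1 / x s in
  let Y := fun s => - (x s * y s + a) * x s in
  x t != 0 -> is_derive t 1 X dX -> is_derive t 1 Y dY ->
  is_derive t 1 x (- dX / X t ^+ 2) /\
  is_derive t 1 y (- (2 * X t * Y t + a) * dX - X t ^+ 2 * dY).
Proof.
move=> X Y xt0 XD YD.
have Xt0 : X t != 0 by rewrite /X div1r invr_eq0.
(* This holds at every [s], zeros of [x] included, because the inverse of 0 is 0. *)
have xE : (fun s => 1 / X s) = x.
  by apply/funext => s; rewrite /X !div1r invrK.
have xD := is_derive_div1 Xt0 XD; rewrite xE in xD.
split=> //; apply: near_eq_is_derive (is_derive_flip a XD YD).
(* Recovering [y s] does require [x s != 0]. Since [x] is now known to be differentiable at [t], it
   is continuous there, hence nonzero near [t]; equality near [t] is enough for the derivative. *)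
have xc : {for t, continuous x}.
  by apply/differentiable_continuous/derivable1_diffP; case: xD.
have xn0 := cvgr_neq0 _ xc xt0.
by near=> s; apply: flipK; near: s; exact: xn0.
Unshelve. all: by end_near. Qed.

Theorem theorem3p3 (R : realType)
    (alpha0 alpha1 alpha2 alpha3 alpha4 : Cplx R)
    (halpha : alpha0 + alpha1 + 2 * alpha2 + alpha3 + alpha4 = 1) :
  let A0 := (alpha0 - alpha1) / 2 in
  let A1 := alpha1 in
  let A2 := alpha2 in
  let A3 := alpha3 in
  let A4 := alpha4 in
  [/\ 2 * A0 + 2 * A1 + 2 * A2 + A3 + A4 = 1,
      (* (x, y) |-> (X, Y) is a bijection from {x <> 0} onto {X <> 0} *)
      set_bij [set p : Cplx R * Cplx R | p.1 != 0]
              [set q : Cplx R * Cplx R | q.1 != 0]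
              (fun p => (1 / p.1, - (p.1 * p.2 + alpha1) * p.1)) &
      forall (D : set (Cplx R)) (x y z w : Cplx R -> Cplx R),
        (forall t, D t -> t != 0) ->
        (forall t, D t -> x t != 0) ->
        let X := fun t => 1 / x t in
        let Y := fun t => - (x t * y t + alpha1) * x t in
        let Z := z in
        let W := w in
        D4_system alpha0 alpha1 alpha3 alpha4 D x y z w <->
        hamiltonian_system (H_B4 A0 A1 A3 A4) D X Y Z W].
Proof.
move=> A0 A1 A2 A3 A4.
have A0E : 2 * A0 = alpha0 - alpha1 by rewrite /A0; field.
split.
- by rewrite A0E -[RHS]halpha /A1 /A2 /A3 /A4; ring.
- have inv1 (u : Cplx R) : 1 / (1 / u) = u by rewrite !div1r invrK.
  split=> [[u v] /= u0|[u v] [u' v']|[u v] /= u0].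
  + by rewrite div1r invr_eq0.
  (* Injectivity: flipping the common image again gives back both points. *)
  + rewrite !inE /= => u0 u0' [uE vE].
    have uu' : u = u' by rewrite -(inv1 u) uE inv1.
    by rewrite -(flipK alpha1 v u0) uE vE flipK// uu'.
  (* The map is its own inverse, so the image of a point is also its preimage. *)
  + exists (1 / u, - (u * v + alpha1) * u) => /=.
      by rewrite div1r invr_eq0.
    by rewrite inv1 flipK.
move=> D x y z w D0 x0 X Y Z W.
(* In each of the four partial derivatives, [c] collects the terms free of the varying coordinate.
   Division by [t] is multiplication by an inverse that [ring] treats as an atom, so the formulas
   hold at [t = 0] as well. *)
have HY t : derive1 (fun v => H_B4 A0 A1 A3 A4 t (X t) v (Z t) (W t)) (Y t) =
    (2 * X t ^+ 2 * Y t - t * X t ^+ 2 - 2 * A0 * X t + 1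
      + 2 * X t ^+ 2 * W t) / t.
  pose c := (Z t ^+ 2 * W t * (W t - t) - Z t * ((1 - A3 - A4) * W t + A3 * t)
    + W t - X t * A1 * t + 2 * X t * W t * A1) / t.
  rewrite (@derive1_quadratic _ _ (X t ^+ 2 / t)
    ((- t * X t ^+ 2 - 2 * A0 * X t + 1 + 2 * X t ^+ 2 * W t) / t) c).
    by ring.
  by move=> u; rewrite /H_B4 /c; ring.
have HX t : derive1 (fun v => H_B4 A0 A1 A3 A4 t v (Y t) (Z t) (W t)) (X t) =
    (2 * X t * Y t * (Y t - t) - 2 * A0 * Y t - A1 * t
      + 4 * X t * Y t * W t + 2 * A1 * W t) / t.
  pose c := (Z t ^+ 2 * W t * (W t - t) - Z t * ((1 - A3 - A4) * W t + A3 * t)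
    + W t + Y t) / t.
  rewrite (@derive1_quadratic _ _ ((Y t * (Y t - t) + 2 * Y t * W t) / t)
    ((- 2 * A0 * Y t - A1 * t + 2 * A1 * W t) / t) c).
    by ring.
  by move=> u; rewrite /H_B4 /c; ring.
have HW t : derive1 (fun v => H_B4 A0 A1 A3 A4 t (X t) (Y t) (Z t) v) (W t) =
    (2 * Z t ^+ 2 * W t - t * Z t ^+ 2 - (1 - A3 - A4) * Z t + 1
      + 2 * X t * (X t * Y t + A1)) / t.
  pose c := (X t ^+ 2 * Y t * (Y t - t) - X t * (2 * A0 * Y t + A1 * t) + Y t
    - Z t * A3 * t) / t.
  rewrite (@derive1_quadratic _ _ (Z t ^+ 2 / t)
    ((- t * Z t ^+ 2 - (1 - A3 - A4) * Z t + 1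
      + 2 * X t * (X t * Y t + A1)) / t) c).
    by ring.
  by move=> u; rewrite /H_B4 /c; ring.
have HZ t : derive1 (fun v => H_B4 A0 A1 A3 A4 t (X t) (Y t) v (W t)) (Z t) =
    (2 * Z t * W t * (W t - t) - (1 - A3 - A4) * W t - A3 * t) / t.
  pose c := (X t ^+ 2 * Y t * (Y t - t) - X t * (2 * A0 * Y t + A1 * t) + Y t
    + W t + 2 * X t * W t * (X t * Y t + A1)) / t.
  rewrite (@derive1_quadratic _ _ (W t * (W t - t) / t)
    ((- (1 - A3 - A4) * W t - A3 * t) / t) c).
    by ring.
  by move=> u; rewrite /H_B4 /c; ring.
split=> S t Dt; have t0 := D0 _ Dt; have xt0 := x0 _ Dt.
- have [xD yD zD wD] := S t Dt; rewrite HX HY HZ HW; split.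
  + apply: is_derive_eq (is_derive_div1 xt0 xD) _.
    by rewrite A0E /X /Y /W; field; rewrite xt0 t0.
  + apply: is_derive_eq (is_derive_flip alpha1 xD yD) _.
    by rewrite A0E /X /Y /W /A1; field; rewrite xt0 t0.
  (* The coupling terms match because [X * Y + A1 = - x * y], whence
     [2 * X * (X * Y + A1) = - 2 * y]. *)
  + apply: is_derive_eq zD _.
    by rewrite /X /Y /Z /W /A1 /A3 /A4; field; rewrite xt0 t0.
  + apply: is_derive_eq wD _.
    by rewrite /Z /W /A3 /A4; field; rewrite t0.
- have [] := S t Dt; rewrite HX HY HZ HW => XD YD zD wD.
  (* The values obtained are expressed in [X] and [Y]; unfolding these turns each equation into a
     rational identity in [x], [y], [w] and [t]. *)
  have [xD yD] := is_derive_unflip xt0 XD YD; split.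
  + apply: is_derive_eq xD _.
    by rewrite A0E /X /Y /W; field; rewrite xt0 t0.
  + apply: is_derive_eq yD _.
    by rewrite A0E /X /Y /W /A1; field; rewrite xt0 t0.
  + apply: is_derive_eq zD _.
    by rewrite /X /Y /Z /W /A1 /A3 /A4; field; rewrite xt0 t0.
  + apply: is_derive_eq wD _.
    by rewrite /Z /W /A3 /A4; field; rewrite t0.
Qed.
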